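(* Let $m,n\ge1$ and let $F\subseteq\{1,\dots,m\}\times\{1,\dots,n\}$ be a binary image with row sums $(r_1,\dots,r_m)$ and column sums $(c_1,\dots,c_n)$, where $r_1=n$ and $r_m=0$. Let $L_h(F)$ be the length of the horizontal boundary of $F$. Define $b_i=\#\{j:c_j\ge i\}$ and $d_i=b_i-r_i$ for $i=1,\dots,m$. Let $k$ be an integer with $2\le k\le m-1$ such that $d_k<0$ and $d_{k+1}\ge 0$, and let $\sigma=\sum_{i=1}^k d_i$. Then for all integers $t,s\ge0$, every set of indices $\{i_1<i_2<\dots<i_{2t+1}\}\subseteq\{1,2,\dots,k,m\}$ and every set of indices $\{\tilde i_1<\tilde i_2<\dots<\tilde i_{2s+1}\}\subseteq\{1,k+1,k+2,\dots,m\}$, \[ L_h(F)\ \ge\ 2n+\big(d_{i_1}-d_{i_2}+d_{i_3}-\cdots-d_{i_{2t}}+2d_{i_{2t+1}}\big)+\big(d_{\tilde i_1}-d_{\tilde i_2}+d_{\tilde i_3}-\cdots-d_{\tilde i_{2s}}+2d_{\tilde i_{2s+1}}\big)-\sigma. \]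
   Context: A binary image is a finite set $F\subseteq\mathbb Z^2$; point $(i,j)$ lies in row $i$ and column $j$. The row sum $r_i$ is the number of points of $F$ in row $i$, and the column sum $c_j$ is the number of points of $F$ in column $j$. The horizontal boundary of $F$ is the set of ordered pairs of points $((i,j),(i',j))$ of $\mathbb Z^2$ with $|i-i'|=1$, $(i,j)\in F$ and $(i',j)\notin F$; its length is the number of such pairs. *)

(* Defs.v *)
From HB Require Import structures.
From mathcomp Require Import all_boot all_order all_algebra.
Set Implicit Arguments. Unset Strict Implicit. Unset Printing Implicit Defensive.
Import Order.TTheory GRing.Theory Num.Theory.

(* A binary image inside {1..m} x {1..n} is represented by its indicator
   F : nat -> nat -> bool (F i j = true iff the point (i,j) is in the image);
   the theorem assumes F i j = false outside {1..m} x {1..n}. *)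

Definition rowsum (n : nat) (F : nat -> nat -> bool) (i : nat) : nat :=
  \sum_(1 <= j < n.+1) (F i j : nat).

Definition colsum (m : nat) (F : nat -> nat -> bool) (j : nat) : nat :=
  \sum_(1 <= i < m.+1) (F i j : nat).

(* length of the horizontal boundary: number of ordered pairs
   ((i,j),(i',j)) with |i - i'| = 1, (i,j) in F, (i',j) not in F.
   Since F lies in {1..m} x {1..n}, i ranges over 1..m, j over 1..n,
   and i' is i-1 or i+1 (both >= 0, so nat indices suffice). *)
Definition hboundary (m n : nat) (F : nat -> nat -> bool) : nat :=
  \sum_(1 <= i < m.+1) \sum_(1 <= j < n.+1)
     (F i j : nat) * ((~~ F i.-1 j : nat) + (~~ F i.+1 j : nat)).

Definition bseq (m n : nat) (F : nat -> nat -> bool) (i : nat) : nat :=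
  \sum_(1 <= j < n.+1) (i <= colsum m F j : nat).

Definition dseq (m n : nat) (F : nat -> nat -> bool) (i : nat) : int :=
  (bseq m n F i)%:Z - (rowsum n F i)%:Z.

Definition altsum (d : nat -> int) (s : seq nat) : int :=
  (\sum_(p < (size s).-1) (-1) ^+ p * d (nth 0%N s p))%R
  + (2%:Z * d (last 0%N s))%R.

(* Main.v *)
(** Everything is a sum over columns. For a column with [c] points let
    [e_i = [i <= c] - [row i is occupied]]; then [d] is the sum of the [e]'s, and
    the column contributes twice its number [1 + S] of runs to the boundary.
    An alternating sum of [e] is at most [2 S], since every positive
    contribution is paid for by the beginning of a run, and it is also at most
    the sum of the [|e_i|] used, which is compared with
    [q = e_1 + ... + e_k >= 0].
    If [c <= k], the sum over [I] is at most [2 S] and the one over [J] at most [q].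
    If [c > k], the roles are exchanged, except that the sum over [I] can be
    [q + 1] when its last index [i] is a gap of the column. If [i < k] and row [k]
    is occupied, a run begins between rows [i] and [k], which leaves at most
    [2 S - 1] for [J]; if row [k] is a gap, [e_k = 1] is not used by [I] and the
    bound is [q] after all. The case [i = k] is removed beforehand. *)
Require Import Defs.
From HB Require Import structures.
From mathcomp Require Import all_boot all_order all_algebra.
From mathcomp Require Import zify.
Import Order.TTheory GRing.Theory Num.Theory.

(** * Alternating sums with a doubled last term *)

Section AlternatingSums.
Set Implicit Arguments.
Unset Strict Implicit.
Local Open Scope ring_scope.
Implicit Types (d e : nat -> int) (I : seq nat).

(** Indices are peeled off in pairs, so the signs of the rest do not change and its doubled last
    term stays in place. *)
Lemma odd_size_ind (T : Type) (P : seq T -> Prop) :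
    (forall x, P [:: x]) ->
    (forall x y z s, odd (size s) = false -> P (z :: s) -> P [:: x, y, z & s]) ->
  forall s, odd (size s) -> P s.
Proof.
move=> P1 P3 s; have [n] := ubnP (size s); elim: n s => // n IHn.
case=> [|x [|y [|z s]]] //= lt_n; rewrite !negbK => odd_s.
apply: P3; first by case: (odd _) odd_s.
by apply: IHn => //=; lia.
Qed.

Lemma altsum1 d x : altsum d [:: x] = 2%:Z * d x.
Proof. by rewrite /altsum big_ord0 add0r. Qed.

Lemma altsum_cons3 d x y z s :
  altsum d [:: x, y, z & s] = d x - d y + altsum d (z :: s).
Proof.
rewrite /altsum /= !big_ord_recl /= expr0 mul1r expr1 mulN1r !addrA.
apply: f_equal2 => //; apply: f_equal2 => //; apply: eq_bigr => i _.
by rewrite !exprS mulrA mulrNN !mul1r.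
Qed.

Lemma altsum_sum (T : Type) (r : seq T) (P : pred T) (e : T -> nat -> int) I :
  altsum (fun i => \sum_(j <- r | P j) e j i) I = \sum_(j <- r | P j) altsum (e j) I.
Proof.
rewrite /altsum big_split /= -mulr_sumr.
by under eq_bigr => p _ do rewrite mulr_sumr; rewrite exchange_big.
Qed.

Lemma eq_altsum d e : d =1 e -> altsum d =1 altsum e.
Proof. by move=> de I; rewrite /altsum de; under eq_bigr do rewrite de. Qed.

Lemma altsum_rcons d x I : altsum d (rcons I x) =
  \sum_(p < size I) (-1) ^+ p * d (nth 0%N I p) + 2%:Z * d x.
Proof.
rewrite /altsum last_rcons size_rcons /=; apply: f_equal2 => //.
by apply: eq_bigr => i _; rewrite nth_rcons ltn_ord.
Qed.

(* Every index occurs at most once, so only the doubled last term can exceed the sum of the [|d i|]. *)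
Lemma altsum_le_abs d I : odd (size I) ->
  altsum d I <= (\sum_(i <- I) `|d i|)%N%:Z + d (last 0%N I).
Proof.
move: I; apply: odd_size_ind => [x|x y z s _ IH].
  by rewrite altsum1 big_seq1 /=; lia.
rewrite altsum_cons3 2!big_cons.
by move: IH => /=; lia.
Qed.

End AlternatingSums.

(** * Runs and excesses in a single column *)

Section Column.
Set Implicit Arguments.
Unset Strict Implicit.

Variables (m : nat) (f : nat -> bool).

Local Notation c := (\sum_(1 <= i < m.+1) f i).

(** Counts the runs that begin strictly after row [a]. When row 1 is occupied, [starts 1] counts all
    runs but the first. *)
Definition starts (a : nat) : nat :=
  \sum_(a.+1 <= i < m.+1) (~~ f i.-1 && f i).

Definition excess (i : nat) : int := ((i <= c)%:Z - (f i)%:Z)%R.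

Lemma starts_decr a b : a <= b <= m -> starts b <= starts a.
Proof.
by move=> /andP[ab bm]; rewrite /starts [leqRHS](big_cat_nat (n := b.+1)) //= leq_addl.
Qed.

(** Passing from a gap at [a] to a point at [b] forces a run to begin in between; in the other cases
    monotonicity is enough. *)
Lemma starts_crossing a b : a <= b <= m -> starts b + f b <= starts a + f a.
Proof.
move=> /andP[ab bm].
rewrite {2}/starts (big_cat_nat (n := b.+1)) //= -/(starts b).
rewrite addnAC [leqRHS]addnC leq_add2l.
elim: b ab {bm} => [|b IHb]; first by rewrite leqn0 => /eqP->; lia.
rewrite leq_eqVlt => /predU1P[->|]; first by lia.
rewrite ltnS => ab; rewrite big_nat_recr //=.
by have := IHb ab; case: (f b); case: (f b.+1); lia.
Qed.

Lemma count_prefix x : \sum_(1 <= i < x.+1) f i <= x.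
Proof.
apply: (@leq_trans (\sum_(1 <= i < x.+1) 1)); last by rewrite sum_nat_const_nat; lia.
by apply: leq_sum => i _; case: (f i).
Qed.

(* A gap within the first [c] rows must be compensated by a point below it. *)
Lemma starts_after_gap x : 1 <= x <= c -> ~~ f x -> 0 < starts x.
Proof.
move=> /andP[x1 xc] fx; have xm := leq_trans xc (count_prefix m).
rewrite lt0n; apply/negP => /eqP s0.
have f0 i : x <= i < m.+1 -> f i = false.
  move=> ixm; have := @starts_crossing x i.
  by rewrite s0 (negbTE fx); case: (f i) => //; lia.
move: xc; rewrite (big_cat_nat (n := x)) //=; last by lia.
rewrite [X in _ + X]big_nat_cond [X in _ + X]big1 ?addn0; last first.
  by move=> i /andP[ixm _]; rewrite f0.
by case: x x1 {fx xm s0 f0} => // x _; have := count_prefix x; lia.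
Qed.

(** Without a gap before [y], the first [y] rows would hold more than [c] points; the run containing
    [y] begins after such a gap. *)
Lemma starts_before_point y : c < y <= m -> f y -> 0 < starts 1.
Proof.
move=> /andP[cy ym] fy.
have [/hasP[x]|/hasPn nogap] := boolP (has (predC f) (index_iota 1 y)).
  rewrite mem_index_iota /= => /andP[x1 xy] fx.
  have := @starts_crossing x y; have := @starts_decr 1 x.
  by rewrite (negbTE fx) fy; lia.
suff : y <= c by lia.
rewrite (big_cat_nat (n := y.+1)) //=.
rewrite (eq_big_nat _ _ (F2 := fun=> 1)); first by rewrite sum_nat_const_nat; lia.
move=> i /andP[i1]; rewrite ltnS leq_eqVlt => /predU1P[->|iy]; first by rewrite fy.
by have := nogap i; rewrite mem_index_iota i1 iy /= negbK => ->.
Qed.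

(* The second alternative occurs when some pair straddles the row [c]. *)
Lemma altsum_le_starts I : odd (size I) -> sorted ltn I ->
    all (fun i => 1 <= i <= m) I -> let x := head 0 I in
  (altsum excess I <= (if (c < x)%N then starts x else (starts x).*2)%N%:Z
  \/ altsum excess I <= (starts x).+1%:Z /\ ((x <= c) && (0 < starts 1))%N)%R.
Proof.
move: I; apply: odd_size_ind => [x|x y z s odd_s IH] /=.
  move=> _ /andP[/andP[x1 xm] _]; left; rewrite altsum1 /excess.
  have := @starts_after_gap x; rewrite x1 /=.
  by move: c => C; case: (ltnP C x) => xc /=; case: (f x) => //=; lia.
move=> /and3P[xy yz zs] /and4P[/andP[x1 xm] /andP[y1 ym] zm sm].
have {IH} := IH zs; rewrite /= zm sm => /(_ isT).
have zm' : z <= m by case/andP: zm.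
rewrite altsum_cons3; move: (altsum _ _) => A.
have := @starts_decr y z; have := @starts_decr x y; have := @starts_decr 1 x.
have := @starts_crossing x y; have := @starts_after_gap x.
have := @starts_before_point y.
rewrite ym (ltnW xy) (ltnW yz) x1 xm zm' /excess /= !andbT.
move: (starts x) (starts y) (starts z) (starts 1) => Nx Ny Nz N1; move: c => C.
(* If [x] and [y] lie on the same side of row [c], the pair gains 1 only when [x] is a gap and [y] a
   point, and then a run begins between them. A straddling pair can gain 2, but the rest lies past
   row [c] and is at most [starts z]. *)
case: (ltnP C x) => cx; case: (ltnP C y) => cy; case: (ltnP C z) => cz; try lia;
case: (f x); case: (f y) => //=; lia.
Qed.

(** The condition [0 < starts 1] of the second alternative brings its bound below twice
    [starts 1]. *)
Lemma altsum_le_starts1 I : odd (size I) -> sorted ltn I ->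
  all (fun i => 1 <= i <= m) I -> (altsum excess I <= (starts 1).*2%:Z)%R.
Proof.
move=> oddI sortI inI.
have := altsum_le_starts oddI sortI inI.
case: I oddI sortI inI => //= x s _ _ /andP[/andP[x1 xm] _].
have := @starts_decr 1 x; rewrite x1 xm => /(_ isT).
by case: ifP => _; lia.
Qed.

(** * Columns with occupied first row and empty last row *)

Hypotheses (m_gt0 : 0 < m) (f1 : f 1) (fm : f m = false).

Lemma card_lt : 0 < c < m.
Proof.
case: m m_gt0 fm f1 => // -[|m'] _ fm' f1'; first by rewrite fm' in f1'.
rewrite big_nat_recr //= fm' addn0 ltnS count_prefix andbT.
by rewrite big_ltn // f1'.
Qed.

Lemma excess1 : excess 1 = 0%R.
Proof. by rewrite /excess f1; case/andP: card_lt => -> _. Qed.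

Lemma excessm : excess m = 0%R.
Proof. by rewrite /excess fm leqNgt; case/andP: card_lt => _ ->. Qed.

Lemma sum_prefix k : \sum_(1 <= i < k.+1) (i <= c) = minn k c.
Proof.
elim: k => [|k IHk]; first by rewrite big_nil min0n.
by rewrite big_nat_recr //= IHk; lia.
Qed.

Lemma sum_excess k :
  (\sum_(1 <= i < k.+1) excess i = (minn k c)%:Z - (\sum_(1 <= i < k.+1) f i)%N%:Z)%R.
Proof.
by rewrite sumrB -sum_prefix !(big_morph Posz PoszD (erefl _)).
Qed.

Lemma sum_abs_excess k : k <= c ->
  (\sum_(1 <= i < k.+1) excess i = (\sum_(1 <= i < k.+1) `|excess i|)%N%:Z)%R.
Proof.
move=> kc; rewrite (big_morph Posz PoszD (erefl _)); apply: eq_big_nat => i ik.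
by rewrite /excess (_ : i <= c); [case: (f i) | lia].
Qed.

(** Both sides count the points after row [k]: on the left as [c] minus the points up to [k], on the
    right because each such point has excess -1. *)
Lemma sum_abs_excess_le k : c <= k <= m ->
  (\sum_(1 <= i < k.+1) excess i = (\sum_(k.+1 <= i < m.+1) `|excess i|)%N%:Z)%R.
Proof.
move=> /andP[ck km]; rewrite sum_excess.
rewrite (_ : (\sum_(k.+1 <= i < m.+1) `|excess i|)%N = \sum_(k.+1 <= i < m.+1) f i).
  have := erefl c; rewrite [in RHS](big_cat_nat (n := k.+1)) //=.
  by move: c ck => C; lia.
apply: eq_big_nat => i ik.
by rewrite /excess (_ : (i <= c) = false); [case: (f i) | lia].
Qed.

Lemma sum_uniq_le (g : nat -> nat) (I L : seq nat) : uniq I -> uniq L ->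
  {subset I <= L} -> \sum_(i <- I) g i <= \sum_(i <- L) g i.
Proof. by move=> uI uL IL; apply: uniq_sub_le_big => // x y; apply: leq_addr. Qed.

(* The entry [1] of [J] may be traded for [k], as both excesses vanish. *)
Lemma altsum_le_starts_from k J : 1 <= k < c -> f k ->
    odd (size J) -> sorted ltn J -> all (fun i => (i == 1) || (k.+1 <= i <= m)) J ->
  (altsum excess J <= (starts k).*2%:Z \/ altsum excess J <= (starts k).+1%:Z)%R.
Proof.
move=> /andP[k1 kc] fk oddJ sortJ inJ.
have km : k < m by case/andP: card_lt; lia.
have ek : excess k = 0%R by rewrite /excess fk ltnW.
have [x [s [eqA oddxs sortxs inxs kx]]] : exists x s,
  [/\ altsum excess J = altsum excess (x :: s), odd (size (x :: s)), sorted ltn (x :: s),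
      all (fun i => 1 <= i <= m) (x :: s) & k <= x].
  case: J oddJ sortJ inJ => // x s odds sorts /= /andP[xJ sJ].
  have s1 : all (fun i => k < i <= m) s.
    apply/allP => i is_; have := allP sJ _ is_; have := allP (order_path_min ltn_trans sorts) _ is_.
    by case/orP: xJ => /=; lia.
  have s2 : all (fun i => 1 <= i <= m) s.
    by apply/allP => i /(allP s1); lia.
  have [x_eq1|x_neq1] := eqVneq x 1; last first.
    exists x, s; split=> //=; last by lia.
    by rewrite s2 andbT; lia.
  exists k, s; split=> //=.
  - case: s odds {sorts sJ s1 s2} => [|y [|z s]] //= _; rewrite x_eq1.
      by rewrite !altsum1 ek excess1.
    by rewrite !altsum_cons3 ek excess1.
  - rewrite path_min_sorted; last by apply: sub_all s1 => i /andP[].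
    exact: path_sorted sorts.
  - by rewrite k1 (ltnW km).
rewrite eqA; have := altsum_le_starts oddxs sortxs inxs; rewrite /=.
have := @starts_decr k x; rewrite kx; case/andP: inxs => /andP[_ ->] _ /(_ isT).
by case: ifP => _; lia.
Qed.

(** Excesses vanish in row 1 and are nonpositive past row [k], so the extra last term in
    [altsum_le_abs] is harmless. *)
Lemma altsum_le_sum_short k J : 0 < k < m -> c <= k -> odd (size J) -> uniq J ->
    all (fun i => (i == 1) || (k.+1 <= i <= m)) J ->
  (altsum excess J <= \sum_(1 <= i < k.+1) excess i)%R.
Proof.
move=> /andP[k0 km] ck oddJ uJ /allP inJ.
rewrite sum_abs_excess_le; last by rewrite ck ltnW.
have lJ : last 0 J \in J by case: (J) oddJ => //= x s _; apply: mem_last.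
have eJ : (excess (last 0%N J) <= 0)%R.
  case/orP: (inJ _ lJ) => [/eqP->|/andP[lk _]]; first by rewrite excess1.
  by rewrite /excess leqNgt (leq_ltn_trans ck lk) /=; case: (f _).
apply: le_trans (altsum_le_abs excess oddJ) _.
rewrite -[leRHS]addr0 lerD // lez_nat.
have -> : \sum_(k.+1 <= i < m.+1) `|excess i| =
    \sum_(i <- 1 :: index_iota k.+1 m.+1) `|excess i| by rewrite big_cons excess1.
apply: sum_uniq_le => //=; first by rewrite iota_uniq andbT mem_index_iota ltnNge k0.
by move=> i /inJ; rewrite inE mem_index_iota ltnS.
Qed.

Lemma altsum_le_sum_long k I : 0 < k < c -> odd (size I) -> sorted ltn I ->
    all (fun i => (1 <= i <= k) || (i == m)) I -> last 0 I != k ->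
  (altsum excess I <= \sum_(1 <= i < k.+1) excess i \/
   altsum excess I <= \sum_(1 <= i < k.+1) excess i + 1 /\ (f k && (starts k < starts 1)%N))%R.
Proof.
move=> /andP[k0 kc] oddI sortI /allP inI.
have km : k < m by case/andP: card_lt => _; apply: ltn_trans.
have uI := sorted_uniq ltn_trans ltnn sortI.
rewrite sum_abs_excess; last exact: ltnW.
have := altsum_le_abs excess oddI.
case/lastP: I oddI sortI inI uI => // I l _ sortI inI uI.
rewrite last_rcons => leA lk.
have [lm|l_neq_m] := eqVneq l m.
  left; apply: le_trans leA _; rewrite lm excessm addr0 lez_nat.
  have -> : \sum_(1 <= i < k.+1) `|excess i| =
      \sum_(i <- m :: index_iota 1 k.+1) `|excess i| by rewrite big_cons excessm.
  apply: sum_uniq_le => //=; first by rewrite -lm.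
    by rewrite iota_uniq andbT mem_index_iota ltnS [m <= k]leqNgt km andbF.
  by rewrite -lm => i /inI; rewrite inE mem_index_iota lm orbC.
(* The last index is neither [m] nor [k], so all of the list stays below [k] and [excess k] is free
   to pay for the doubled term. *)
have {inI} IL : {subset rcons I l <= index_iota 1 k}.
  have l1k : 1 <= l < k.
    have := inI l; rewrite mem_rcons mem_head (negbTE l_neq_m) orbF => /(_ isT).
    by rewrite [l < k]ltn_neqAle lk.
  move=> i iI; have := inI i iI.
  move: iI; rewrite mem_index_iota mem_rcons inE => /predU1P[->//|iI].
  move: sortI; rewrite (sorted_pairwise ltn_trans) pairwise_rcons.
  by move=> /andP[/allP/(_ _ iI) /= il _]; clear - l1k il km; lia.
have /andP[l1 {}lk] : 1 <= l < k by rewrite -mem_index_iota IL // mem_rcons mem_head.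
have leS := sum_uniq_le (fun i => `|excess i|) uI (iota_uniq _ _) IL.
rewrite big_nat_recr //=.
have el : excess l = (~~ f l)%:Z%R.
  by rewrite /excess (ltnW (ltn_trans lk kc)); case: (f l).
have ek : excess k = (~~ f k)%:Z%R.
  by rewrite /excess (ltnW kc); case: (f k).
have Nkl : f k -> ~~ f l -> starts k < starts 1.
  move=> fk fl; have := @starts_crossing l k; have := @starts_decr 1 l.
  by rewrite fk (negbTE fl); clear - l1 lk km; lia.
rewrite el in leA; rewrite ek; move: leA leS Nkl.
move: (altsum _ _) (\sum_(i <- _) _) (\sum_(1 <= i < k) _) => A S1 S2; clear.
by case: (f k); case: (f l) => /= *; lia.
Qed.

Lemma column_bound k I J : 0 < k < m ->
    odd (size I) -> sorted ltn I -> all (fun i => (1 <= i <= k) || (i == m)) I ->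
    last 0 I != k ->
    odd (size J) -> sorted ltn J -> all (fun i => (i == 1) || (k.+1 <= i <= m)) J ->
  (altsum excess I + altsum excess J - \sum_(1 <= i < k.+1) excess i
     <= (starts 1).*2%:Z)%R.
Proof.
move=> k0m oddI sortI inI lastI oddJ sortJ inJ.
have [ck|kc] := leqP c k.
  have AI : (altsum excess I <= (starts 1).*2%:Z)%R.
    by apply: altsum_le_starts1 => //; apply: sub_all inI => i; clear - k0m; lia.
  have := altsum_le_sum_short k0m ck oddJ (sorted_uniq ltn_trans ltnn sortJ) inJ.
  by clear - AI; lia.
have AJ : (altsum excess J <= (starts 1).*2%:Z)%R.
  by apply: altsum_le_starts1 => //; apply: sub_all inJ => i; clear - k0m; lia.
have k0c : 0 < k < c by rewrite kc andbT; case/andP: k0m.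
have [|[AI /andP[fk Nk]]] := altsum_le_sum_long k0c oddI sortI inI lastI.
  by clear - AJ; lia.
(* As [starts k < starts 1], either bound for [J] is at most twice [starts 1] minus 1, which absorbs
   the extra 1 from [I]. *)
by case: (altsum_le_starts_from k0c fk oddJ sortJ inJ); clear - AI Nk; lia.
Qed.

Lemma column_hboundary : f 0 = false -> f m.+1 = false ->
  \sum_(1 <= i < m.+1) f i * (~~ f i.-1 + ~~ f i.+1) = (starts 1).*2.+2.
Proof.
move=> f0 fm1.
(* Each run has two ends; the correction term is the far end, not yet counted, of a run that
   continues past row [M]. *)
have H M : \sum_(1 <= i < M.+1) f i * (~~ f i.-1 + ~~ f i.+1) + (f M && f M.+1)
         = (\sum_(1 <= i < M.+1) (~~ f i.-1 && f i)).*2.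
  elim: M => [|M IHM]; first by rewrite !big_nil f0.
  rewrite big_nat_recr // [in RHS]big_nat_recr // doubleD -IHM /=.
  by case: (f M); case: (f M.+1); case: (f M.+2); lia.
have := H m; rewrite fm addn0 => ->.
by rewrite /starts big_ltn ?f0 ?f1 //=; case/andP: card_lt; lia.
Qed.

End Column.

(** * Summation over the columns *)

Theorem theorem5p1 (m n : nat) (F : nat -> nat -> bool) (k : nat)
  (hm : (1 <= m)%N) (hn : (1 <= n)%N)
  (hF : forall i j, F i j -> (1 <= i <= m)%N && (1 <= j <= n)%N)
  (hr1 : rowsum n F 1 = n) (hrm : rowsum n F m = 0%N)
  (hk : (2 <= k <= m - 1)%N)
  (hdk : (dseq m n F k < 0)%R) (hdk1 : (0 <= dseq m n F k.+1)%R) :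
  forall (t s : nat) (I J : seq nat),
    size I = (2 * t).+1 -> sorted ltn I ->
    all (fun i => ((1 <= i <= k) || (i == m))%N) I ->
    size J = (2 * s).+1 -> sorted ltn J ->
    all (fun i => ((i == 1) || (k.+1 <= i <= m))%N) J ->
    ((2 * n)%:Z + altsum (dseq m n F) I + altsum (dseq m n F) J
       - \sum_(1 <= i < k.+1) dseq m n F i
     <= (hboundary m n F)%:Z)%R.
Proof.
move=> t s I J szI sortI inI szJ sortJ inJ.
have k0m : 0 < k < m by clear - hk; lia.
have km : k < m by case/andP: k0m.
have Fm j : F m j = false.
  apply/negP => Fmj; have /andP[_ /andP[j1 jn]] := hF _ _ Fmj.
  have jI : j \in index_iota 1 n.+1 by rewrite mem_index_iota j1.
  by move: hrm; rewrite /rowsum (big_rem j) //= Fmj.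
have F1 j : 1 <= j < n.+1 -> F 1 j.
  move=> j1n; have jI : j \in index_iota 1 n.+1 by rewrite mem_index_iota.
  apply/negPn/negP => F1j.
  have : rowsum n F 1 < n.
    rewrite /rowsum (big_rem j) //= (negbTE F1j) add0n.
    apply: (@leq_ltn_trans (\sum_(y <- rem j (index_iota 1 n.+1)) 1)).
      by apply: leq_sum => i _; case: (F 1 i).
    by rewrite sum1_size size_rem // size_iota subn1 /= prednK // subn1.
  by rewrite hr1 ltnn.
have F0 j : F 0 j = false by apply/negP => /hF.
have FSm j : F m.+1 j = false by apply/negP => /hF; rewrite ltnn.
pose e j := excess m (F^~ j).
have dE : dseq m n F =1 fun i => (\sum_(1 <= j < n.+1) e j i)%R.
  by move=> i; rewrite /dseq /bseq /rowsum !(big_morph Posz PoszD (erefl _)) -sumrB.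
have em : dseq m n F m = 0%R.
  rewrite dE big_nat_cond big1 // => j /andP[j1n _].
  by apply: excessm; rewrite ?F1 ?Fm.
(* As [d_k < 0 = d_m], a final index [k] of [I] may be replaced by [m]. *)
wlog lastI : I szI sortI inI / last 0 I != k.
  move=> gen; have [lk|/gen] := eqVneq (last 0 I) k; last exact.
  case/lastP: I lk szI sortI inI => // I l; rewrite last_rcons => -> szI sortI inI.
  have /gen : size (rcons I m) = (2 * t).+1 by rewrite size_rcons -szI size_rcons.
  rewrite last_rcons (gtn_eqF km) => {}gen.
  apply: le_trans (gen _ _ isT).
  - rewrite !altsum_rcons em; move: hdk; move: (dseq m n F k) => dk; lia.
  - move: sortI; rewrite !(sorted_pairwise ltn_trans) !pairwise_rcons.
    case/andP=> lt_k ->; rewrite andbT; apply: sub_all lt_k => i /=.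
    by move/ltn_trans; apply.
  - by move: inI; rewrite !all_rcons => /andP[_ ->]; rewrite eqxx orbT.
(* Each column receives 2, the contribution of its run beginning in row 1. *)
have -> : ((2 * n)%:Z = \sum_(1 <= j < n.+1) 2%:Z)%R.
  by rewrite big_const_nat iter_addr_0 subn1 /=; lia.
rewrite /hboundary exchange_big /= (big_morph Posz PoszD (erefl _)).
rewrite !(eq_altsum dE) !altsum_sum (eq_bigr _ (fun i _ => dE i)) exchange_big /=.
rewrite -!big_split /= -sumrB; apply: ler_sum_nat => j /F1 F1j.
rewrite column_hboundary //; have := @column_bound m (F^~ j) hm F1j (Fm j) k I J k0m.
rewrite szI szJ /= !mul2n !odd_double => /(_ isT sortI inI lastI isT sortJ inJ).
rewrite -/(e j); move: (altsum _ I) (altsum _ J) (\sum_(1 <= i < _) _)%R (starts _ _ _).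
by clear => A1 A2 S N; lia.
Qed.
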